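(* Let $A$ be a ring and $M$ an $A$-bimodule with $ann_l(M)\subseteq ann_r(M)$. If the trivial extension $A\propto M$ is a regular left fusible ring and $Zd_l(M)\subseteq zd_l(A)$, then $A$ is a regular left fusible ring and $M=0$.
   Context: Rings are associative with identity, not necessarily commutative. For an $A$-bimodule $M$, $ann_l(M)=\{x\in A: xM=0\}$, $ann_r(M)=\{x\in A: Mx=0\}$, and $Zd_l(M)=\{a\in A: am=0\text{ for some }0\neq m\in M\}$. For a ring $A$, $zd_l(A)=\{a\in A: ax=0\text{ for some }0\neq x\in A\}$ is the set of left zero divisors of $A$. The trivial extension $A\propto M=\{(a,m): a\in A, m\in M\}$ is the ring with componentwise addition, multiplication $(a,m)(b,m')=(ab,am'+mb)$ and identity $(1,0)$. An element of a ring is regular if it is neither a left nor a right zero divisor. A nonzero element $a$ of a ring is left fusible if $a=z+r$ with $z$ a left zero divisor and $r$ not a left zero divisor. A ring is regular left fusible if for every nonzero element $a$ there is a regular element $s$ such that $sa$ is left fusible. *)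

(* Defs.v *)
From HB Require Import structures.
From mathcomp Require Import all_boot all_algebra.
From mathcomp Require Import classical_sets.

Set Implicit Arguments.
Unset Strict Implicit.
Unset Printing Implicit Defensive.

Import GRing.Theory.

Local Open Scope ring_scope.
Local Open Scope classical_set_scope.

(* Rings are [pzRingType]s: associative, unital, not necessarily commutative,
   and possibly zero. *)

(* [ract m a] is m a, for a unital A-bimodule M whose left action is the
   library's [a *: m]. *)
HB.mixin Record Lmodule_isBimodule (A : pzRingType) M of GRing.Lmodule A M := {
  ract : M -> A -> M;
  ractDl : forall (m m' : M) (a : A), ract (m + m') a = ract m a + ract m' a;
  ractDr : forall (m : M) (a b : A), ract m (a + b) = ract m a + ract m b;
  ractM : forall (m : M) (a b : A), ract m (a * b) = ract (ract m a) b;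
  ract1 : forall m : M, ract m 1 = m;
  scale_ract : forall (a : A) (m : M) (b : A),
    ract (a *: m) b = a *: ract m b
}.

#[short(type="bimodType")]
HB.structure Definition Bimodule (A : pzRingType) :=
  {M of Lmodule_isBimodule A M & GRing.Lmodule A M}.

Notation "m *:< a" := (ract m a) (at level 40, left associativity) : ring_scope.

(* A named copy of the product: the ring structure declared on it must not
   compete with the componentwise one that [A * M] has when M is a ring. *)
Definition triv_ext (A : pzRingType) (M : bimodType A) : Type := (A * M)%type.

Notation "A ∝ M" := (@triv_ext A M) (at level 40, no associativity) : type_scope.

Section TrivialExtension.
Variables (A : pzRingType) (M : bimodType A).
Implicit Types x y z : A ∝ M.

HB.instance Definition _ := GRing.Zmodule.copy (A ∝ M) (A * M)%type.

Definition triv_ext_one : A ∝ M := (1, 0).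

Definition triv_ext_mul x y : A ∝ M :=
  (x.1 * y.1, x.1 *: y.2 + x.2 *:< y.1).

Fact triv_ext_mulA : associative triv_ext_mul.
Proof.
move=> x y z; congr pair; rewrite /= ?mulrA //.
by rewrite scalerDr ractDl scalerA ractM scale_ract addrA.
Qed.

Fact triv_ext_mul1 : left_id triv_ext_one triv_ext_mul.
Proof.
move=> [a m]; rewrite /triv_ext_mul /= mul1r scale1r.
have r0 : (0 : M) *:< a = 0.
  by apply: (addrI ((0 : M) *:< a)); rewrite -ractDl !addr0.
by rewrite r0 addr0.
Qed.

Fact triv_ext_1mul : right_id triv_ext_one triv_ext_mul.
Proof.
by move=> [a m]; rewrite /triv_ext_mul /= mulr1 scaler0 add0r ract1.
Qed.

Fact triv_ext_mulDl : left_distributive triv_ext_mul +%R.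
Proof.
move=> x y z; congr pair; rewrite /= ?mulrDl //.
by rewrite scalerDl ractDl addrACA.
Qed.

Fact triv_ext_mulDr : right_distributive triv_ext_mul +%R.
Proof.
move=> x y z; congr pair; rewrite /= ?mulrDr //.
by rewrite scalerDr ractDr addrACA.
Qed.

HB.instance Definition _ := GRing.Zmodule_isPzRing.Build (A ∝ M)
  triv_ext_mulA triv_ext_mul1 triv_ext_1mul triv_ext_mulDl triv_ext_mulDr.

End TrivialExtension.

Section Annihilators.
Variables (A : pzRingType) (M : bimodType A).

Definition ann_l : set A := [set x | forall m : M, x *: m = 0].
Definition ann_r : set A := [set x | forall m : M, m *:< x = 0].
Definition Zd_l : set A := [set a | exists2 m : M, m <> 0 & a *: m = 0].

End Annihilators.

Arguments ann_l {A} M.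
Arguments ann_r {A} M.
Arguments Zd_l {A} M.

Section Fusible.
Variable R : pzRingType.
Implicit Types a s : R.

Definition zd_l : set R := [set a | exists2 x : R, x <> 0 & a * x = 0].
Definition zd_r : set R := [set a | exists2 x : R, x <> 0 & x * a = 0].

Definition regular s : Prop := ~ zd_l s /\ ~ zd_r s.

Definition left_fusible a : Prop :=
  a <> 0 /\ exists z r : R, [/\ a = z + r, zd_l z & ~ zd_l r].

End Fusible.

Arguments zd_l R : clear implicits.
Arguments zd_r R : clear implicits.

Definition regular_left_fusible (R : pzRingType) : Prop :=
  forall a : R, a <> 0 -> exists2 s : R, regular s & left_fusible (s * a).

(* Main.v *)
Require Import Defs.
From HB Require Import structures.
From mathcomp Require Import all_boot all_algebra.
From mathcomp Require Import classical_sets.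

(** No element [(0, m)] of the trivial extension is left fusible, and this is
    what forces [M] to vanish.  Suppose [(0, m) = (a, n) + (- a, n')] with the
    first summand a left zero divisor, say [(a, n) (b, p) = 0], and the second
    not.  Elements [(0, q)] cannot be killed by [(- a, n')], so [a] acts
    injectively on [M]; hence [b] is nonzero, while [a b = 0] gives
    [a (b q) = 0], so [b q = 0] for every [q].  Thus [b] annihilates [M] on the
    left, therefore also on the right, and [(- a, n') (b, 0) = 0], which is
    absurd ([triv_ext_ideal_not_fusible]).

    As [s (0, m)] is again of the form [(0, m')], regular left fusibility of
    [A ∝ M] leaves no nonzero [m].  The first projection is then a ring
    isomorphism onto [A], and regular left fusibility is invariant under
    isomorphism ([regular_left_fusible_iso]). *)

Set Implicit Arguments.
Unset Strict Implicit.
Unset Printing Implicit Defensive.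

Import GRing.Theory.

Local Open Scope ring_scope.
Local Open Scope classical_set_scope.

Section Isomorphism.
Variables (R S : pzRingType) (f : {rmorphism R -> S}) (g : S -> R).
Hypotheses (fK : cancel f g) (gK : cancel g f).

Lemma iso_neq0 x : f x <> 0 <-> x <> 0.
Proof.
split=> nz E; apply: nz; first by rewrite E rmorph0.
by apply: (can_inj fK); rewrite rmorph0.
Qed.

Lemma zd_l_iso x : zd_l S (f x) <-> zd_l R x.
Proof.
split=> -[y y0 xy0].
  exists (g y); first by apply/iso_neq0; rewrite gK.
  by apply: (can_inj fK); rewrite rmorphM gK rmorph0.
by exists (f y); [apply/iso_neq0 | rewrite -rmorphM xy0 rmorph0].
Qed.

Lemma zd_r_iso x : zd_r S (f x) <-> zd_r R x.
Proof.
split=> -[y y0 yx0].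
  exists (g y); first by apply/iso_neq0; rewrite gK.
  by apply: (can_inj fK); rewrite rmorphM gK rmorph0.
by exists (f y); [apply/iso_neq0 | rewrite -rmorphM yx0 rmorph0].
Qed.

Lemma regular_left_fusible_iso :
  regular_left_fusible R -> regular_left_fusible S.
Proof.
move=> fusR a a0.
have /fusR[s [sl sr] [sa0 [z [r [saE zz rz]]]]] : g a <> 0.
  by apply/iso_neq0; rewrite gK.
have fsaE : f s * a = f (s * g a) by rewrite rmorphM gK.
exists (f s); first by split=> [/zd_l_iso | /zd_r_iso].
split; first by rewrite fsaE; apply/iso_neq0.
exists (f z), (f r); split; first by rewrite fsaE saE rmorphD.
  exact/zd_l_iso.
by move=> /zd_l_iso.
Qed.

End Isomorphism.

Section TrivialExtension.
Variables (A : pzRingType) (M : bimodType A).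

Lemma ract0r (m : M) : m *:< (0 : A) = 0.
Proof. by apply: (addrI (m *:< (0 : A))); rewrite -ractDr !addr0. Qed.

Lemma triv_ext_mulE (x y : A ∝ M) :
  x * y = (x.1 * y.1, x.1 *: y.2 + x.2 *:< y.1).
Proof. by []. Qed.

Definition triv_ext_fst (x : A ∝ M) : A := x.1.

Fact triv_ext_fst_zmod_morphism : zmod_morphism triv_ext_fst.
Proof. by []. Qed.

Fact triv_ext_fst_monoid_morphism : monoid_morphism triv_ext_fst.
Proof. by []. Qed.

HB.instance Definition _ := GRing.isZmodMorphism.Build (A ∝ M) A
  triv_ext_fst triv_ext_fst_zmod_morphism.
HB.instance Definition _ := GRing.isMonoidMorphism.Build (A ∝ M) A
  triv_ext_fst triv_ext_fst_monoid_morphism.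

(** The action of [a] on [M] is the left multiplication by [(a, n)] restricted
    to the ideal of the pairs [(0, m)], whatever [n] is. *)
Lemma Zd_l_zd_l (a : A) (n : M) : Zd_l M a -> zd_l (A ∝ M) (a, n).
Proof.
move=> [m m0 am0]; exists ((0, m) : A ∝ M); first by case.
by rewrite triv_ext_mulE /= mulr0 am0 ract0r addr0.
Qed.

(** In a decomposition of [(0, m)] the two summands have opposite first
    components [a] and [- a], so they act on [M] by the same map up to sign.
    The condition on annihilators excludes the remaining way for [(a, n)] to
    be a left zero divisor: through an element [b] with [b M = 0]. *)
Lemma triv_ext_ideal_not_fusible (m : M) :
  ann_l M `<=` ann_r M -> ~ left_fusible ((0, m) : A ∝ M).
Proof.
move=> annlr [_ [[a n] [[c n'] [E [[b p] bp0 E0] nzr]]]].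
have {E} cE : c = - a.
  by apply/eqP; rewrite -addr_eq0 addrC; case: E => <- _.
have {E0} [ab0 apnb] : a * b = 0 /\ a *: p + n *:< b = 0 by case: E0.
have a_inj (q : M) : a *: q = 0 -> q = 0.
  move=> aq0; have [//|/eqP q0] := eqVneq q 0.
  by case: nzr; apply: Zd_l_zd_l; exists q; rewrite // cE scaleNr aq0 oppr0.
have bl : ann_l M b by move=> q; apply: a_inj; rewrite scalerA ab0 scale0r.
have br := annlr b bl.
have b0 : b <> 0.
  move=> b0; apply: bp0; congr pair => //; apply: a_inj.
  by rewrite br addr0 in apnb.
apply: nzr; exists ((b, 0) : A ∝ M); first by case.
by rewrite triv_ext_mulE /= cE mulNr ab0 oppr0 scaler0 br addr0.
Qed.

Lemma triv_ext_fusible_eq0 :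
    ann_l M `<=` ann_r M -> regular_left_fusible (A ∝ M) ->
  forall m : M, m = 0.
Proof.
move=> annlr fus m; have [//|/eqP m0] := eqVneq m 0.
have /fus[[s n] _] : ((0, m) : A ∝ M) <> 0 by case.
by rewrite triv_ext_mulE /= mulr0 => /(triv_ext_ideal_not_fusible annlr).
Qed.

End TrivialExtension.

Theorem theorem7 (A : pzRingType) (M : bimodType A)
  (hann : ann_l M `<=` ann_r M)
  (hfus : regular_left_fusible (A ∝ M))
  (hzd : Zd_l M `<=` zd_l A) :
  regular_left_fusible A /\ (forall m : M, m = 0).
Proof.
have M0 := triv_ext_fusible_eq0 hann hfus; split=> //.
pose emb (a : A) : A ∝ M := (a, 0).
apply: (@regular_left_fusible_iso _ _ (@triv_ext_fst A M) emb) hfus => //.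
by move=> [a m]; rewrite /emb (M0 m).
Qed.
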